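(* Let $(\Gamma,\alpha,\nabla)$ be an abstract $(m,n)$-type GKM graph, and let $\ell$ be an integer with $n\le \ell\le m$. Then the following two statements are equivalent: (1) ${\rm rk}\ \mathcal{A}(\Gamma,\alpha,\nabla)\ge \ell$; (2) there is an $(m,\ell)$-type GKM graph $(\Gamma,\widetilde{\alpha},\nabla)$ which is an extension of $(\Gamma,\alpha,\nabla)$.
   Context: Graphs. $\Gamma=(V(\Gamma),E(\Gamma))$ is a finite connected graph without loops (multiple edges allowed); $E(\Gamma)$ is the set of oriented edges, each edge occurring with both orientations; $i(e)$, $t(e)$ are the initial and terminal vertices of $e$, and $\overline{e}$ is $e$ with reversed orientation. $E_p(\Gamma)=\{e\in E(\Gamma): i(e)=p\}$. $\Gamma$ is $m$-valent if $|E_p(\Gamma)|=m$ for all $p\in V(\Gamma)$. $(m,n)$-type GKM graph ($1\le n\le m$). This is a triple $(\Gamma,\alpha,\nabla)$, where $\Gamma$ is $m$-valent, $\alpha:E(\Gamma)\to H^2(BT^n)\simeq\mathbb{Z}^n$ (integer coefficients) is a function, and $\nabla=\{\nabla_e : e\in E(\Gamma)\}$ (the connection) is a collection of bijections $\nabla_e:E_{i(e)}(\Gamma)\to E_{t(e)}(\Gamma)$, such that: (1) $\alpha(e)=-\alpha(\overline{e})$; (2) for each $p\in V(\Gamma)$ and each pair of distinct edges $e,e'\in E_p(\Gamma)$, $\alpha(e),\alpha(e')$ are linearly independent; (3) $\nabla_{\overline{e}}=\nabla_e^{-1}$, $\nabla_e(e)=\overline{e}$, and for each $e\in E(\Gamma)$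 and $e'\in E_{i(e)}(\Gamma)$ there is an integer $c_e(e')$ (the congruence coefficient of $e'$ on $e$) with $\alpha(\nabla_e(e'))-\alpha(e')=c_e(e')\alpha(e)$; (4) (effectiveness) for each $p\in V(\Gamma)$ the set $\{\alpha(e): e\in E_p(\Gamma)\}$ spans $H^2(BT^n)$ over $\mathbb{Z}$. Extension. For $\ell\ge n$, an $(m,\ell)$-type GKM graph $(\Gamma,\widetilde\alpha,\nabla)$ (same graph, same connection) is an extension of $(\Gamma,\alpha,\nabla)$ if there is a projection (surjective homomorphism) $\pi:H^2(BT^\ell)\to H^2(BT^n)$ with $\pi\circ\widetilde\alpha=\alpha$. Group of axial functions. Let $\mathbb{Z}E_p(\Gamma)\simeq\mathbb{Z}^m$ be the free abelian group with basis $E_p(\Gamma)$; for $x\in\mathbb{Z}E_p(\Gamma)$ and $e\in E_p(\Gamma)$ let $x_e\in\mathbb{Z}$ be the coefficient of $e$ in $x$. Let $N_e:\mathbb{Z}E_{i(e)}(\Gamma)\to\mathbb{Z}E_{t(e)}(\Gamma)$ be the isomorphism sending each basis element $e'$ to $\nabla_e(e')$, and let $c_{(\Gamma,\alpha,\nabla)}(e)=\sum_{e'\in E_{i(e)}(\Gamma)}c_e(e')\,e'\in\mathbb{Z}E_{i(e)}(\Gamma)$. Then $\mathcal{A}(\Gamma,\alpha,\nabla)$ is the subgroup of all $f\in\bigoplus_{p\in V(\Gamma)}\mathbb{Z}E_p(\Gamma)$, $f=(f(p))_p$, satisfying for every $e\in E(\Gamma)$, with $p=i(e)$, $q=t(e)$,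 $$N_e(f(p))-f(q)=f(q)_{\overline{e}}\;c_{(\Gamma,\alpha,\nabla)}(\overline{e}).$$ It is a free abelian group of finite rank, and ${\rm rk}$ denotes its rank. *)

(* Defs.v *)
From HB Require Import structures.
From mathcomp Require Import all_boot all_order all_algebra.
From mathcomp Require Import boolp classical_sets.
From Stdlib Require List.

Set Implicit Arguments.
Unset Strict Implicit.
Unset Printing Implicit Defensive.

Import Order.TTheory GRing.Theory Num.Theory.
Local Open Scope ring_scope.

Definition zbasis (U : zmodType) (A : set U) (r : nat) (b : 'I_r -> U) : Prop :=
  [/\ forall i, A (b i),
      forall c : 'I_r -> int, \sum_i b i *~ c i = 0 -> forall i, c i = 0 &
      forall x, A x -> exists c : 'I_r -> int, x = \sum_i b i *~ c i].

(* The value is meaningful when [A] is a free abelian group of finite rank (and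
   is 0 if [A] has no finite basis); see [zbasis_rk] and [zbasis_axial_group]. *)
Definition rk (U : zmodType) (A : set U) : nat :=
  xget 0%N [set r | exists b : 'I_r -> U, zbasis A b]%classic.

(* [edge] is the set of oriented edges. Since there are no loops, [rev] has no
   fixed point. *)
Record graph := Graph {
  vertex : finType;
  edge : finType;
  init : edge -> vertex;
  term : edge -> vertex;
  rev : edge -> edge;
  revK : involutive rev;
  init_rev : forall e, init (rev e) = term e;
  no_loop : forall e, init e != term e;
  vertex_nonempty : (0 < #|vertex|)%N;
  graph_connected : forall p q : vertex,
    connect (fun x y => [exists e, (init e == x) && (term e == y)]) p q }.

Section GKM.
Variable G : graph.
Notation V := (vertex G).
Notation E := (edge G).

Definition star (p : V) : {set E} := [set e | init e == p].

Definition valent (m : nat) : Prop := forall p : V, #|star p| = m.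

(* [nabla e] is only relevant on [star (init e)]. *)
Record connection_axioms (nabla : E -> E -> E) : Prop := {
  connection_inj : forall e, {in star (init e) &, injective (nabla e)};
  connection_im : forall e, nabla e @: star (init e) = star (term e);
  connection_rev : forall e, {in star (init e), cancel (nabla e) (nabla (rev e))};
  connection_self : forall e, nabla e e = rev e }.

Record is_gkm (m n : nat) (alpha : E -> 'rV[int]_n) (nabla : E -> E -> E)
    : Prop := {
  gkm_type : (1 <= n <= m)%N;
  gkm_valent : valent m;
  gkm_connection : connection_axioms nabla;
  gkm_rev : forall e, alpha e = - alpha (rev e);
  gkm_indep : forall p, {in star p &, forall e e', e != e' ->
    forall a b : int, alpha e *~ a + alpha e' *~ b = 0 -> a = 0 /\ b = 0};
  gkm_congruence : forall e, {in star (init e), forall e', exists c : int,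
    alpha (nabla e e') - alpha e' = alpha e *~ c};
  gkm_effective : forall p (v : 'rV[int]_n), exists c : E -> int,
    v = \sum_(e in star p) alpha e *~ c e }.

Definition is_extension (n l : nat) (alpha : E -> 'rV[int]_n)
    (alpha' : E -> 'rV[int]_l) : Prop :=
  exists pi : {additive 'rV[int]_l -> 'rV[int]_n},
    (forall v, exists u, pi u = v) /\ (forall e, pi (alpha' e) = alpha e).

(* For a GKM graph the coefficient exists and is unique when
   [e' \in star (init e)]; see [congr_coefP]. *)
Definition congr_coef (n : nat) (alpha : E -> 'rV[int]_n) (nabla : E -> E -> E)
    (e e' : E) : int :=
  xget 0 [set c | alpha (nabla e e') - alpha e' = alpha e *~ c]%classic.

(* The free abelian group on [star p] is realised as the subgroup of
   [{ffun E -> int}] of the functions supported on [star p]. *)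
Definition in_ZE (p : V) (x : {ffun E -> int}) : Prop :=
  forall e, e \notin star p -> x e = 0.

Definition edge_basis (e : E) : {ffun E -> int} := [ffun e1 => (e1 == e)%:R].

Definition transport (nabla : E -> E -> E) (e : E) (x : {ffun E -> int})
    : {ffun E -> int} :=
  \sum_(e' in star (init e)) edge_basis (nabla e e') *~ x e'.

Definition congr_vec (n : nat) (alpha : E -> 'rV[int]_n) (nabla : E -> E -> E)
    (e : E) : {ffun E -> int} :=
  \sum_(e' in star (init e)) edge_basis e' *~ congr_coef alpha nabla e e'.

Definition axial_group (n : nat) (alpha : E -> 'rV[int]_n)
    (nabla : E -> E -> E) : set {ffun V -> {ffun E -> int}} :=
  [set f : {ffun V -> {ffun E -> int}} | (forall p, in_ZE p (f p)) /\
    forall e, transport nabla e (f (init e)) - f (term e) =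
      congr_vec alpha nabla (rev e) *~ (f (term e) (rev e))]%classic.

End GKM.

Lemma congr_coefP (G : graph) m n (alpha : edge G -> 'rV[int]_n) nabla e e' c :
  is_gkm m alpha nabla -> e' \in star (init e) ->
  alpha (nabla e e') - alpha e' = alpha e *~ c <->
  c = congr_coef alpha nabla e e'.
Proof.
move=> H He'.
have ez : alpha e != 0.
  apply/eqP => a0; have [/cards1P[x sx]|/negP s1] := boolP (#|star (init e)| == 1%N).
    have /andP[n0 _] := gkm_type H.
    have ex : e = x by apply/set1P; rewrite -sx inE.
    have [d] := gkm_effective H (init e) (const_mx 1).
    rewrite sx big_set1 -ex a0 mul0rz => /matrixP/(_ 0 (Ordinal n0)).
    by rewrite !mxE => /eqP; rewrite oner_eq0.
  have es : e \in star (init e) by rewrite inE.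
  have : (0 < #|star (init e) :\ e|)%N.
    rewrite card_gt0; apply/eqP => s0; apply: s1.
    by rewrite (cardsD1 e) es s0 cards0.
  case/card_gt0P => x; rewrite !inE => /andP[xe xi].
  have xs : x \in star (init e) by rewrite inE.
  have ex : e != x by rewrite eq_sym.
  have := gkm_indep H es xs ex (a := 1) (b := 0).
  by rewrite a0 mul0rz mulr0z addr0 => /(_ erefl) [].
have C : alpha (nabla e e') - alpha e' =
    alpha e *~ congr_coef alpha nabla e e'.
  have [d Hd] := gkm_congruence H He'.
  exact: (@xgetPex _ 0
    [set c | alpha (nabla e e') - alpha e' = alpha e *~ c]%classic (ex_intro _ d Hd)).
split=> [|-> //]; rewrite C => /matrixP eqc.
have /rV0Pn[j nzj] := ez.
have := eqc 0 j; rewrite -!scaler_int !mxE => /(mulIf nzj).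
by rewrite !intz => ->.
Qed.

Lemma zbasis_size (U : zmodType) (A : set U) r s (b : 'I_r -> U) (b' : 'I_s -> U) :
  zbasis A b -> zbasis A b' -> r = s.
Proof.
suff le r1 s1 (b1 : 'I_r1 -> U) (b2 : 'I_s1 -> U) :
    zbasis A b1 -> zbasis A b2 -> (r1 <= s1)%N.
  by move=> h h'; apply/eqP; rewrite eqn_leq (le _ _ _ _ h h') (le _ _ _ _ h' h).
move=> [A1 f1 g1] [A2 f2 g2].
have /fin_all_exists[P HP] := fun i => g2 _ (A1 i).
have /fin_all_exists[Q HQ] := fun i => g1 _ (A2 i).
apply: (@mulmx1_min _ _ _ (\matrix_(i, j) P i j) (\matrix_(j, i) Q j i)).
apply/matrixP=> i k; apply/eqP; rewrite -subr_eq0; apply/eqP.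
move: k; apply: f1; under eq_bigr do rewrite mulrzBr.
rewrite sumrB [X in _ - X](_ : _ = b1 i); last first.
  rewrite (bigD1 i) //= big1 ?addr0 => [|k ki]; rewrite mxE ?eqxx //.
  by rewrite eq_sym (negbTE ki).
apply/eqP; rewrite subr_eq0; apply/eqP; rewrite [RHS](HP i).
under [RHS]eq_bigr do rewrite HQ mulrz_suml.
rewrite exchange_big /=; apply: eq_bigr => k _.
rewrite mxE mulrz_sumr; apply: eq_bigr => j _.
by rewrite !mxE mulrC mulrzA.
Qed.

Lemma zbasis_rk (U : zmodType) (A : set U) r (b : 'I_r -> U) :
  zbasis A b -> rk A = r.
Proof.
move=> hb; rewrite /rk; case: xgetP => [s _ [b' hb']|/(_ r) []].
  exact: zbasis_size hb' hb.
by exists b.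
Qed.

Lemma zbasis_exists (U : zmodType) (A : set U) (phis : seq {additive U -> int}) :
    A 0 -> (forall x y, A x -> A y -> A (x - y)) ->
    (forall x, A x -> (forall phi, List.In phi phis -> phi x = 0) -> x = 0) ->
  exists r (b : 'I_r -> U), zbasis A b.
Proof.
elim: phis A => [|phi phis IH] A A0 AB Asep.
  exists 0%N, (fun=> 0); split=> [[]//|c _ []//|x Ax].
  by exists (fun=> 0); rewrite big_ord0; apply: Asep.
have AN x : A x -> A (- x) by move=> Ax; rewrite -sub0r; apply: AB.
have AD x y : A x -> A y -> A (x + y).
  by move=> Ax Ay; rewrite -[y]opprK; apply: AB => //; apply: AN.
have AM x c : A x -> A (x *~ c).
  move=> Ax; elim/int_ind: c => [|k IHk|k IHk]; first by rewrite mulr0z.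
    by rewrite intS mulrzDr mulr1z; apply: AD.
  by rewrite intS opprD mulrzDr mulrN1z; apply: AD => //; apply: AN.
have [phi0|] := pselect (forall x, A x -> phi x = 0).
  by apply: IH => // x Ax h; apply: Asep => // psi [<-|]; [exact: phi0|exact: h].
move=> /existsNP[x0 /not_implyP[Ax0 /eqP phix0]].
pose D := fun d : nat => `[<exists2 x, A x & phi x = d.+1%:Z>].
have exD : exists d, D d.
  exists `|phi x0|%N.-1; apply/asboolP.
  rewrite prednK ?absz_gt0 //; case E: (phi x0) => [k|k]; first by exists x0.
  by exists (- x0); [exact: AN | rewrite raddfN E NegzE opprK].
case: (ex_minnP exD) => d /asboolP[a Aa phia] dmin.
have phidvd x : A x -> exists q : int, phi (x - a *~ q) = 0.
  move=> Ax; exists (phi x %/ d.+1%:Z)%Z; apply/eqP; apply: contraTT isT.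
  set y := x - _ => y0.
  have phiy : phi y = (phi x %% d.+1%:Z)%Z.
    by rewrite raddfB raddfMz phia mulrzz mulrC /modz.
  have Ay : A y by apply: AB => //; apply: AM.
  have yge : 0 <= phi y by rewrite phiy modz_ge0.
  have ylt : phi y < d.+1%:Z by rewrite phiy ltz_pmod.
  case E: (phi y) yge ylt y0 => [[|k]|k] // _ ylt _.
  have : D k by apply/asboolP; exists y.
  by move/dmin; rewrite leqNgt; move: ylt; rewrite ltz_nat ltnS => ->.
pose A' : set U := [set x | A x /\ phi x = 0]%classic.
have [||x [Ax phix] h|r [b [Ab fb gb]]] := IH A'.
- by split=> //; rewrite raddf0.
- by move=> x y [Ax px] [Ay py]; split; [exact: AB | rewrite raddfB px py].
- by apply: Asep => // psi [<-|]; [exact: phix|exact: h].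
exists r.+1, (fun i => if unlift ord0 i is Some j then b j else a); split.
- by move=> i; case: unliftP => [j _|_] //; case: (Ab j).
- move=> c; rewrite big_ord_recl unlift_none.
  under eq_bigr do rewrite liftK.
  move=> hc; have c0 : c ord0 = 0.
    have := congr1 phi hc; rewrite raddfD raddf0 raddf_sum big1 => [|j _].
      by rewrite addr0 raddfMz phia => /eqP; rewrite mulrz_eq0 orbF => /eqP.
    by rewrite /= raddfMz (Ab j).2 mul0rz.
  move: hc; rewrite c0 mulr0z add0r => /fb hc i.
  by case: (unliftP ord0 i) => [j ->|->].
- move=> x Ax; have [q hq] := phidvd x Ax.
  have [|c hc] := gb (x - a *~ q); first by split=> //; apply: AB => //; apply: AM.
  exists (fun i => if unlift ord0 i is Some j then c j else q).
  rewrite big_ord_recl unlift_none.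
  under eq_bigr do rewrite liftK.
  by rewrite -hc addrC subrK.
Qed.

Lemma zbasis_axial_group (G : graph) n (alpha : edge G -> 'rV[int]_n) nabla :
  exists b : 'I_(rk (axial_group alpha nabla)) -> _,
    zbasis (axial_group alpha nabla) b.
Proof.
suff [r [b hb]] : exists r (b : 'I_r -> _), zbasis (axial_group alpha nabla) b.
  by rewrite (zbasis_rk hb); exists b.
pose ev p e (f : {ffun vertex G -> {ffun edge G -> int}}) : int := f p e.
have evB p e : zmod_morphism (ev p e) by move=> f g; rewrite /ev !ffunE.
pose phi p e : {additive _ -> int} :=
  HB.pack (ev p e) (GRing.isZmodMorphism.Build _ _ (ev p e) (evB p e)).
have trB e : {morph transport nabla e : x y / x - y}.
  move=> x y; rewrite /transport -sumrB; apply: eq_bigr => e' _.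
  by rewrite !ffunE mulrzBr.
have tr0 e : transport nabla e 0 = 0.
  by rewrite /transport big1 // => e' _; rewrite ffunE mulr0z.
apply: (zbasis_exists
  (phis := [seq phi pe.1 pe.2 | pe <- enum {: vertex G * edge G}])).
- split=> [p e _|e]; first by rewrite !ffunE.
  by rewrite !ffunE tr0 subr0 mulr0z.
- move=> f g [fE fA] [gE gA]; split=> [p e ep|e].
    by rewrite !ffunE fE // gE // subr0.
  by rewrite !ffunE trB mulrzBr -fA -gA opprD addrACA -opprD.
- move=> f _ h; apply/ffunP => p; apply/ffunP => e; rewrite !ffunE.
  have := h (phi p e); apply.
  have : (p, e) \in enum {: vertex G * edge G} by rewrite mem_enum.
  elim: (enum _) => [|pe s IH] //=; rewrite inE => /orP[/eqP<-|/IH]; first by left.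
  by right.
Qed.

(* Main.v *)
(* Reading f as the function e |-> f(i(e))_e identifies the group of axial
   functions with the integer functions on edges that are odd under reversal and
   have the congruence coefficients of alpha.  An axial function is determined by
   its values on one star: since the graph is connected, any subgroup containing
   those values contains all of them.

   The coordinates of an extension to Z^l are l axial functions; as the values on
   a star span Z^l, there are functionals dual to them, so the rank is at least l.
   Conversely, an extension alpha' to Z^l with l below the rank can be enlarged by
   one coordinate: the functionals dual to its coordinates kill some nonzero axial
   function F, which we may divide by the gcd of its values on a star; then
   (F, alpha') still spans Z^(l+1) on that star, hence on every star. *)
Require Import Defs.
From mathcomp Require Import all_boot all_order all_algebra.
From mathcomp Require Import boolp classical_sets.

Set Implicit Arguments.
Unset Strict Implicit.
Unset Printing Implicit Defensive.

Import Order.TTheory GRing.Theory Num.Theory.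
Local Open Scope ring_scope.

(* [all_boot] shadows edge reversal by list reversal. *)
Local Notation rev := Defs.rev.

Lemma bezout_seq (I : eqType) (F : I -> int) (s : seq I) : uniq s ->
  exists c : I -> int, forall i, i \in s -> (\sum_(j <- s) F j * c j %| F i)%Z.
Proof.
elim: s => [_|x s IH /=/andP[xs us]]; first by exists (fun=> 0).
have [c hc] := IH us; set d := \sum_(j <- s) _ in hc.
have [u [v huv]] := Bezoutz (F x) d.
(* Since [x] is not in [s], changing the coefficient at [x] leaves the tail sum equal to [v * d], so
   the new sum is the gcd of [F x] and [d]. *)
exists (fun i => if i == x then u else v * c i) => i.
rewrite big_cons eqxx (_ : \sum_(j <- s) _ = v * d); last first.
  rewrite mulr_sumr; apply: eq_big_seq => j js.
  by case: eqP js => [->|_ _]; [rewrite (negbTE xs) | rewrite mulrCA].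
rewrite mulrC huv inE => /orP[/eqP->|/hc]; first exact: dvdz_gcdl.
exact/dvdz_trans/dvdz_gcdr.
Qed.

Lemma rV_mulrzE k (v : 'rV[int]_k) (a : int) j : (v *~ a) 0 j = v 0 j * a.
Proof. by rewrite -scaler_int mxE intz mulrC. Qed.

(** * Edge functions with prescribed congruence coefficients *)

Section AxialFunctions.
Variables (G : graph) (nabla : edge G -> edge G -> edge G).
Hypothesis conn : connection_axioms nabla.
Notation V := (vertex G).
Notation E := (edge G).
Variable c : E -> E -> int.

(** The codomain is general so that one notion covers vector-valued functions and their integer
    coordinates. *)
Definition axial (U : zmodType) (b : E -> U) : Prop :=
  (forall e, b e = - b (rev e)) /\
  forall e, {in star (init e), forall e', b (nabla e e') - b e' = b e *~ c e e'}.

(* Crossing [e0] turns the value at [e'] into [b e0 *~ c e0 e' + b e']. *)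
Lemma axial_spread (U : zmodType) (b : E -> U) (P : U -> Prop) (p : V) :
    axial b -> (forall x y a, P x -> P y -> P (x *~ a + y)) ->
    {in star p, forall e, P (b e)} -> forall e, P (b e).
Proof.
move=> [_ bc] PL Pp e.
have /connectP[s] := graph_connected p (init e).
elim: s p Pp => [|x s IH] p Pp /= => [_ ie|/andP[/existsP[e0 /andP[]]]].
  by apply: Pp; rewrite inE ie.
move=> /eqP i0 /eqP t0; apply: IH => e1; rewrite -t0 -(connection_im conn e0).
case/imsetP => e' he' ->; rewrite -[b _](subrK (b e')) bc //.
by apply: PL; apply: Pp; [rewrite inE i0 | rewrite -i0].
Qed.

(** The span of the values on [star q] is a subgroup, so by [axial_spread] it contains every value
    of [b], in particular those on [star p]. *)
Lemma axial_effective k (b : E -> 'rV[int]_k) (p : V) : axial b ->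
    (forall v, exists a : E -> int, v = \sum_(e in star p) b e *~ a e) ->
  forall q v, exists a : E -> int, v = \sum_(e in star q) b e *~ a e.
Proof.
move=> bax bp q.
pose P v := exists a : E -> int, v = \sum_(e in star q) b e *~ a e.
have PL x y a : P x -> P y -> P (x *~ a + y).
  case=> d -> [d' ->]; exists (fun e => d e * a + d' e).
  rewrite mulrz_suml -big_split; apply: eq_bigr => e _.
  by rewrite mulrzDr mulrzA.
have Pb : forall e, P (b e).
  apply: (axial_spread (p := q)) => // e eq.
  exists (fun e' => (e' == e)%:R); rewrite (bigD1 e) //= eqxx mulr1z.
  by rewrite big1 ?addr0 // => e' /andP[_ /negbTE->]; rewrite mulr0z.
move=> v; have [a ->] := bp v; rewrite -/(P _).
apply: (big_rec P) => [|e x _]; first by exists (fun=> 0); rewrite big1.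
exact: PL.
Qed.

Lemma axial_coord k (b : E -> 'rV[int]_k) (j : 'I_k) :
  axial b -> axial (fun e => b e 0 j).
Proof.
case=> br bc; split=> [e|e e' he']; first by rewrite [b e]br mxE.
by have /rowP/(_ j) := bc e e' he'; rewrite rV_mulrzE mulrzz !mxE.
Qed.

Lemma axial_row_mx k1 k2 (b1 : E -> 'rV[int]_k1) (b2 : E -> 'rV[int]_k2) :
  axial b1 -> axial b2 -> axial (fun e => row_mx (b1 e) (b2 e)).
Proof.
move=> [r1 c1] [r2 c2]; split=> [e|e e' he'].
  by rewrite r1 r2 opp_row_mx.
rewrite opp_row_mx add_row_mx c1 // c2 //.
by rewrite -!scaler_int scale_row_mx.
Qed.

Lemma axial_scalar (b : E -> int) :
  axial b -> axial (fun e => (b e)%:M : 'rV[int]_1).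
Proof.
move=> [br bc]; split=> [e|e e' he']; first by rewrite br raddfN.
by rewrite -raddfB bc // raddfMz.
Qed.

Lemma axial_sub (U : zmodType) (b1 b2 : E -> U) :
  axial b1 -> axial b2 -> axial (fun e => b1 e - b2 e).
Proof.
move=> [r1 c1] [r2 c2]; split=> [e|e e' he'].
  by rewrite r1 r2 opprB opprK addrC.
rewrite mulrzBl -c1 // -c2 // !opprB [LHS]addrACA [RHS]addrACA.
by congr (_ + _); rewrite addrC.
Qed.

Lemma axial_lin k (b : E -> 'rV[int]_k) (d : 'I_k -> int) :
  axial b -> axial (fun e => \sum_j b e 0 j * d j).
Proof.
move=> [br bc]; split=> [e|e e' he'].
  by rewrite -sumrN; apply: eq_bigr => j _; rewrite br mxE mulNr.
rewrite -sumrB mulrz_suml; apply: eq_bigr => j _.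
have /rowP/(_ j) := bc e e' he'; rewrite rV_mulrzE !mxE => h.
by rewrite -mulrBl h mulrzz mulrAC.
Qed.

(* [F'] is [F] divided by the gcd [d] of its values on [star p]; by
   [axial_spread], [d] divides [F] everywhere. *)
Lemma axial_primitive (F : E -> int) (p : V) e0 : axial F -> F e0 != 0 ->
  exists (F' : E -> int) (d : int) (a : E -> int),
    [/\ axial F', d != 0, forall e, F e = F' e * d &
        \sum_(e in star p) F' e * a e = 1].
Proof.
move=> Fax F0.
have [a0 ha0] := bezout_seq F (enum_uniq (star p)).
set d := \sum_(e <- _) _ in ha0.
have dE : d = \sum_(e in star p) F e * a0 e by rewrite /d big_enum.
have dvd e : (d %| F e)%Z.
  apply: (axial_spread (P := fun x => (d %| x)%Z) (p := p)) => //.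
  - by move=> x y a dx dy; rewrite rpredD // rpredMz.
  - by move=> e1 h; apply: ha0; rewrite mem_enum.
have d0 : d != 0.
  by apply: contraNneq F0 => d0; move: (dvd e0); rewrite d0 dvd0z.
have FE e : F e = (F e %/ d)%Z * d by rewrite divzK.
exists (fun e => (F e %/ d)%Z), d, a0; split=> //.
  case: Fax => Fr Fc; split=> [e|e e' he']; apply: (mulIf d0).
    by rewrite mulNr -!FE.
  by rewrite mulrBl -!FE Fc // !mulrzz mulrAC -FE.
apply: (mulIf d0); rewrite mul1r mulr_suml {}[RHS]dE.
by apply: eq_bigr => e _; rewrite mulrAC -FE.
Qed.

End AxialFunctions.

(** * Congruence coefficients and transport, edge by edge *)

Section AxialGroup.
Variables (m n : nat) (G : graph) (alpha : edge G -> 'rV[int]_n).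
Variable nabla : edge G -> edge G -> edge G.
Hypothesis hG : is_gkm m alpha nabla.
Notation V := (vertex G).
Notation E := (edge G).
Notation c := (congr_coef alpha nabla).
Notation A := (axial_group alpha nabla).
Let conn := gkm_connection hG.

Lemma congr_coef_self e : c e e = - 2.
Proof.
have es : e \in star (init e) by rewrite inE.
apply/esym/(congr_coefP (-2) hG es); rewrite (connection_self conn).
rewrite [alpha e](gkm_rev hG) opprK.
by rewrite mulNrz mulrNz opprK -[2]/(1 + 1) mulrzDr mulr1z.
Qed.

Lemma nabla_star e e' : e' \in star (init e) -> nabla e e' \in star (term e).
Proof. by move=> h; rewrite -(connection_im conn) imset_f. Qed.

(** Reversing [e] negates both sides of the congruence: the difference changes sign, and so does
    [alpha e]. *)
Lemma congr_coef_rev e e' : e' \in star (init e) ->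
  c (rev e) (nabla e e') = c e e'.
Proof.
move=> h; have hs := nabla_star h; rewrite -init_rev in hs.
apply/esym/(congr_coefP _ hG hs); rewrite (connection_rev conn) //.
have /(congr_coefP _ hG h) : c e e' = c e e' by [].
by rewrite [alpha e](gkm_rev hG) mulNrz => /(congr1 -%R); rewrite opprB opprK.
Qed.

Lemma transportE e x e' : e' \in star (init e) ->
  transport nabla e x (nabla e e') = x e'.
Proof.
move=> h; rewrite /transport sum_ffunE (bigD1 e') //= big1 ?addr0 => [|i /andP[hi ie]].
  by rewrite ffunMzE ffunE eqxx intz.
rewrite ffunMzE ffunE; case: eqP => [/(connection_inj conn h hi) E|_].
  by rewrite E eqxx in ie.
by rewrite mul0rz.
Qed.

Lemma transport_out e x e1 : e1 \notin star (term e) -> transport nabla e x e1 = 0.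
Proof.
move=> h; rewrite /transport sum_ffunE big1 // => i hi; rewrite ffunMzE ffunE.
by case: eqP h => [->|_ _]; rewrite ?mul0rz // nabla_star.
Qed.

Lemma congr_vecE e e' :
  congr_vec alpha nabla e e' = if e' \in star (init e) then c e e' else 0.
Proof.
rewrite /congr_vec sum_ffunE; case: ifP => h.
  rewrite (bigD1 e') //= big1 ?addr0 => [|i /andP[_ ie]]; rewrite ffunMzE ffunE.
    by rewrite eqxx intz.
  by rewrite eq_sym (negbTE ie) mul0rz.
rewrite big1 // => i hi; rewrite ffunMzE ffunE; case: eqP => [E|_].
  by rewrite E hi in h.
by rewrite mul0rz.
Qed.

(** * Identification of the axial group with edge functions *)

Definition star_vectors (F : E -> int) : {ffun V -> {ffun E -> int}} :=
  [ffun p => [ffun e => if e \in star p then F e else 0]].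

Definition edge_values (f : {ffun V -> {ffun E -> int}}) (e : E) : int :=
  f (init e) e.

(** At the edge [nabla e e'] the defining equation is the negated congruence for [F], by
    [congr_coef_rev] and oddness of [F]. *)
Lemma star_vectors_in (F : E -> int) : axial nabla c F -> A (star_vectors F).
Proof.
move=> [Fr Fc]; split=> [p e ep|e]; first by rewrite !ffunE (negbTE ep).
apply/ffunP => e1; rewrite ffunE ffunMzE congr_vecE init_rev.
have [|h] := boolP (e1 \in star (term e)); last first.
  by rewrite transport_out // !ffunE (negbTE h) mul0rz subr0.
move=> h; have := h; rewrite -(connection_im conn) => /imsetP[e' he' E1].
rewrite E1 ffunE transportE // -E1 !ffunE he' h E1 congr_coef_rev // inE init_rev eqxx.
by rewrite -opprB Fc // [F e]Fr mulNrz opprK !mulrzz mulrC.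
Qed.

Lemma edge_values_axial f : A f -> axial nabla c (edge_values f).
Proof.
move=> [fE fA].
have fc e e' : e' \in star (init e) ->
    f (init e) e' - f (term e) (nabla e e') = f (term e) (rev e) * c e e'.
  move=> h; have /ffunP/(_ (nabla e e')) := fA e; rewrite !ffunE transportE //.
  rewrite ffunMzE congr_vecE init_rev nabla_star // congr_coef_rev // => ->.
  by rewrite mulrzz mulrC.
have fr e : edge_values f e = - edge_values f (rev e).
  have es : e \in star (init e) by rewrite inE.
  (* With [e' = e] the coefficient is -2 and the equation reads x - y = -2y, which is oddness. *)
  have := fc e e es; rewrite (connection_self conn) congr_coef_self.
  rewrite /edge_values init_rev mulrN mulr_natr mulr2n opprD.
  by move/eqP; rewrite subr_eq addrNK => /eqP.
split=> // e e' he'; rewrite [edge_values f e]fr /edge_values init_rev mulNrz mulrzz.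
have /[!inE]/eqP-> := nabla_star he'; have /[!inE]/eqP-> := he'.
by rewrite -fc // opprB.
Qed.

Lemma edge_valuesK f : A f -> star_vectors (edge_values f) = f.
Proof.
case=> fE _; apply/ffunP => p; apply/ffunP => e; rewrite !ffunE.
by case: ifPn => [|/fE->//]; rewrite inE => /eqP ie; rewrite /edge_values ie.
Qed.

Lemma star_vectorsK (F : E -> int) e : edge_values (star_vectors F) e = F e.
Proof. by rewrite /edge_values !ffunE inE eqxx. Qed.

Lemma edge_values_sum r (b : 'I_r -> {ffun V -> {ffun E -> int}}) d e :
  edge_values (\sum_i b i *~ d i) e = \sum_i edge_values (b i) e * d i.
Proof.
rewrite /edge_values sum_ffunE sum_ffunE; apply: eq_bigr => i _.
by rewrite !ffunMzE mulrzz.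
Qed.

(** * Extensions as vectors of axial functions *)

Lemma extension_axial l (alpha' : E -> 'rV[int]_l) :
  is_gkm m alpha' nabla -> is_extension alpha alpha' -> axial nabla c alpha'.
Proof.
move=> hG' [pi [_ pia]]; split=> [e|e e' he']; first exact: gkm_rev hG' e.
have [d hd] := gkm_congruence hG' he'; rewrite hd; congr (_ *~ _).
(* The image under [pi] of the congruence for [alpha'] is one for [alpha] with the same [d], and
   coefficients of [alpha] are unique. *)
apply/(congr_coefP _ hG he').
by rewrite -!pia -raddfB hd raddfMz.
Qed.

(** A linear relation projects under [pi] to one for [alpha], so independence is inherited; spanning
    on one star gives it on all. *)
Lemma axial_extension_gkm l (alpha' : E -> 'rV[int]_l) p :
    (n <= l <= m)%N -> axial nabla c alpha' -> is_extension alpha alpha' ->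
    (forall v, exists a : E -> int, v = \sum_(e in star p) alpha' e *~ a e) ->
  is_gkm m alpha' nabla.
Proof.
move=> /andP[nl lm] ax [pi [_ pia]] hp; split.
- by rewrite lm andbT (leq_trans _ nl) //; case/andP: (gkm_type hG).
- exact: gkm_valent hG.
- exact: conn.
- by case: ax.
- move=> q e e' he he' ee' a b /(congr1 pi); rewrite raddf0 raddfD !raddfMz !pia.
  exact: gkm_indep hG _ _ _ he he' ee' a b.
- by move=> e e' he'; exists (c e e'); case: ax => _; apply.
- exact: axial_effective ax hp.
Qed.

(** [phi j] holds the coefficients of the [j]-th unit vector in terms of [alpha'] on [star p];
    summing against it is the functional dual to coordinate [j]. *)
Lemma dual_functionals l (alpha' : E -> 'rV[int]_l) p :
    (forall v, exists a : E -> int, v = \sum_(e in star p) alpha' e *~ a e) ->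
  exists phi : 'I_l -> E -> int, forall j k,
    \sum_(e in star p) alpha' e 0 k * phi j e = (k == j)%:R.
Proof.
move=> hp; have /fin_all_exists[phi hphi] := fun j => hp (delta_mx 0 j).
exists phi => j k; have /rowP/(_ k) := hphi j; rewrite !mxE eqxx /= => ->.
by rewrite summxE; apply: eq_bigr => e _; rewrite rV_mulrzE.
Qed.

(** * Lower bound on the rank *)

Lemma rk_ge_extension l (alpha' : E -> 'rV[int]_l) :
    is_gkm m alpha' nabla -> is_extension alpha alpha' ->
  (l <= rk A)%N.
Proof.
move=> hG' ext; have ax := extension_axial hG' ext.
have [p _] := card_gt0P (vertex_nonempty G).
have [phi hphi] := dual_functionals (gkm_effective hG' p).
have [b [_ _ gb]] := zbasis_axial_group alpha nabla.
have /fin_all_exists[P HP] := fun j => gb _ (star_vectors_in (axial_coord j ax)).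
pose Q i j : int := \sum_(e in star p) edge_values (b i) e * phi j e.
(* [P] expands the coordinates of [alpha'] in the basis and [Q] pairs the basis with the
   functionals; duality says that their product is the identity. *)
apply: (@mulmx1_min _ _ _ (\matrix_(j, i) P j i) (\matrix_(i, j) Q i j)).
apply/matrixP => k j; rewrite !mxE -hphi.
have alphaE e : alpha' e 0 k = \sum_i edge_values (b i) e * P k i.
  by rewrite -edge_values_sum -HP star_vectorsK.
under [RHS]eq_bigr do rewrite alphaE mulr_suml.
rewrite exchange_big; apply: eq_bigr => i _; rewrite !mxE mulr_sumr.
by apply: eq_bigr => e _; rewrite mulrCA mulrA.
Qed.

(* If no axial function killed by the functionals dual to [alpha'] is nonzero,
   then the coordinates of [alpha'] form a basis. *)
Lemma axial_kernel l (alpha' : E -> 'rV[int]_l) p (phi : 'I_l -> E -> int) :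
    axial nabla c alpha' ->
    (forall j k, \sum_(e in star p) alpha' e 0 k * phi j e = (k == j)%:R) ->
    (l < rk A)%N ->
  exists F, [/\ axial nabla c F, exists e, F e != 0 &
    forall j, \sum_(e in star p) F e * phi j e = 0].
Proof.
move=> ax hphi lr; apply: contrapT => nF; move: lr; rewrite ltnNge => /negP[].
have ker0 F : axial nabla c F ->
    (forall j, \sum_(e in star p) F e * phi j e = 0) -> forall e, F e = 0.
  move=> Fax hF e; apply: contrapT => /eqP Fe.
  by apply: nF; exists F; split=> //; exists e.
have dual (d : 'I_l -> int) j :
    \sum_(e in star p) (\sum_k alpha' e 0 k * d k) * phi j e = d j.
  under eq_bigr do rewrite mulr_suml.
  rewrite exchange_big /= (bigD1 j) //= [X in _ + X]big1 ?addr0 => [|k kj].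
    under eq_bigr do rewrite mulrAC.
    by rewrite -mulr_suml hphi eqxx mul1r.
  under eq_bigr do rewrite mulrAC.
  by rewrite -mulr_suml hphi (negbTE kj) mul0r.
suff hb : zbasis A (fun j => star_vectors (fun e => alpha' e 0 j)).
  by rewrite (zbasis_rk hb).
have sumE d e : edge_values (\sum_j star_vectors (fun e => alpha' e 0 j) *~ d j) e =
    \sum_j alpha' e 0 j * d j.
  by rewrite edge_values_sum; apply: eq_bigr => j _; rewrite star_vectorsK.
split=> [j|d d0 j|f Af].
- exact/star_vectors_in/axial_coord.
- rewrite -(dual d j) big1 // => e _.
  by rewrite -sumE d0 /edge_values !ffunE mul0r.
- have fax := edge_values_axial Af.
  pose d j := \sum_(e in star p) edge_values f e * phi j e.
  (* Subtracting this combination of coordinates leaves an axial function killed by every [phi j],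
     hence zero. *)
  have fE e : edge_values f e = \sum_j alpha' e 0 j * d j.
    apply/eqP; rewrite -subr_eq0; apply/eqP; move: e; apply: ker0 => [|j].
      exact/axial_sub/axial_lin.
    by under eq_bigr do rewrite mulrBl; rewrite sumrB dual subrr.
  exists d; rewrite -[LHS](edge_valuesK Af).
  apply/ffunP => q; apply/ffunP => e; rewrite sum_ffunE sum_ffunE !ffunE.
  under [RHS]eq_bigr do rewrite !ffunMzE !ffunE.
  case: ifP => _; last by rewrite big1 // => j _; rewrite mul0rz.
  by rewrite fE; apply: eq_bigr => j _; rewrite mulrzz.
Qed.

(** * Adding coordinates to an extension *)

Lemma extension_step l (alpha' : E -> 'rV[int]_l) :
    is_gkm m alpha' nabla -> is_extension alpha alpha' ->
    (n <= l < m)%N -> (l < rk A)%N ->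
  exists alpha'' : E -> 'rV[int]_l.+1,
    is_gkm m alpha'' nabla /\ is_extension alpha alpha''.
Proof.
move=> hG' ext /andP[nl lm] lr; have ax := extension_axial hG' ext.
have [p _] := card_gt0P (vertex_nonempty G).
have [phi hphi] := dual_functionals (gkm_effective hG' p).
have [F0 [F0ax [e0 F0e] F0phi]] := axial_kernel ax hphi lr.
have [F [d [a [Fax d0 F0E Fa]]]] := axial_primitive conn p F0ax F0e.
have Fphi j : \sum_(e in star p) F e * phi j e = 0.
  apply: (mulIf d0); rewrite mul0r mulr_suml -[RHS](F0phi j).
  by apply: eq_bigr => e _; rewrite F0E mulrAC.
(* The new coordinate comes first because [1 + l] is convertible to [l.+1], which avoids a cast. *)
pose alpha'' e : 'rV[int]_(1 + l) := row_mx (F e)%:M (alpha' e).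
have ax'' : axial nabla c alpha'' by apply: axial_row_mx => //; apply: axial_scalar.
have ext'' : is_extension alpha (alpha'' : E -> 'rV_l.+1).
  have [pi [pis pia]] := ext.
  pose tail : {additive 'rV[int]_(1 + l) -> 'rV_l} := rsubmx.
  pose pi' : {additive 'rV[int]_(1 + l) -> 'rV_n} := pi \o tail.
  exists pi'; split=> [v|e] /=.
    by have [u <-] := pis v; exists (row_mx 0 u : 'rV_(1 + l)); rewrite /= row_mxKr.
  by rewrite row_mxKr pia.
exists alpha''; split=> //.
apply: (axial_extension_gkm (p := p)) => //; first by rewrite lm leqW.
move=> v; pose v1 := lsubmx (v : 'rV_(1 + l)) 0 0; pose v2 := rsubmx (v : 'rV_(1 + l)).
(* [x] agrees with [v1] on [F]; the correction makes it agree with [v2] on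
   [alpha'], without changing the value on [F], which the [phi j] kill. *)
pose s j := v2 0 j - v1 * \sum_(e in star p) alpha' e 0 j * a e.
pose x e := v1 * a e + \sum_j s j * phi j e.
exists x; rewrite -[LHS](hsubmxK (v : 'rV_(1 + l))).
have -> : \sum_(e in star p) alpha'' e *~ x e =
    row_mx (\sum_(e in star p) F e * x e)%:M (\sum_(e in star p) alpha' e *~ x e).
  apply: (big_rec3 (fun y z w => w = row_mx y%:M z)) => [|e y z w _ ->].
    by rewrite raddf0 row_mx0.
  rewrite -!scaler_int !intz scale_row_mx add_row_mx scale_scalar_mx.
  by rewrite -raddfD mulrC.
have pair (g : E -> int) : \sum_(e in star p) g e * x e =
    v1 * (\sum_(e in star p) g e * a e) +
    \sum_j s j * \sum_(e in star p) g e * phi j e.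
  under eq_bigr do rewrite mulrDr mulr_sumr.
  rewrite big_split exchange_big /= mulr_sumr; congr (_ + _).
    by apply: eq_bigr => e _; rewrite mulrCA.
  by apply: eq_bigr => j _; rewrite mulr_sumr; apply: eq_bigr => e _; rewrite mulrCA.
apply: (f_equal2 (@row_mx int 1 1 l)).
  rewrite pair Fa mulr1 big1 ?addr0 => [|j _]; last by rewrite Fphi mulr0.
  exact: mx11_scalar.
apply/rowP => k; rewrite summxE.
under eq_bigr do rewrite rV_mulrzE.
rewrite pair (bigD1 k) //= hphi eqxx mulr1 [X in _ + (_ + X)]big1 ?addr0 => [|j jk].
  by rewrite subrKC.
by rewrite hphi eq_sym (negbTE jk) mulr0.
Qed.

Lemma extension_exists l : (n <= l <= m)%N -> (l <= rk A)%N ->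
  exists alpha' : E -> 'rV[int]_l,
    is_gkm m alpha' nabla /\ is_extension alpha alpha'.
Proof.
elim: l => [|l IH] /andP[].
  (* The case [l = 0] is void because [n] is positive; the induction really starts at [l = n], with
     [alpha] itself. *)
  by have /andP[n0 _] := gkm_type hG; rewrite leqNgt n0.
rewrite leq_eqVlt => /predU1P[<- _ _|]; last rewrite ltnS => nl lm lr.
  by exists alpha; split=> //; exists idfun; split=> // v; exists v.
have [|alpha' [hG' ext]] := IH _ (ltnW lr); first by rewrite nl ltnW.
by apply: extension_step hG' ext _ lr; rewrite nl lm.
Qed.

End AxialGroup.

Theorem theorem1p2 (m n l : nat) (G : graph) (alpha : edge G -> 'rV[int]_n)
    (nabla : edge G -> edge G -> edge G) (hG : is_gkm m alpha nabla)
    (hl : (n <= l <= m)%N) :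
  (l <= rk (axial_group alpha nabla))%N <->
  exists alpha' : edge G -> 'rV[int]_l,
    is_gkm m alpha' nabla /\ is_extension alpha alpha'.
Proof.
split=> [lr|[alpha' [hG' ext]]]; first exact: (extension_exists hG).
exact: (rk_ge_extension hG hG' ext).
Qed.
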